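(* Let $\Lambda\subset[-1,1)$ be finite and nonempty with $s=|\Lambda|$, let $2\le k\le n$, assume that every spherical $\Lambda$-code in $S^{n-1}$ with at most $k-2$ points is linearly independent, and let $d\ge0$ be an integer. Use the notation of the context. For each nonempty $R\in\mathcal R_{k-2}$ replace the degree-zero block $M_{R,0}$ by $$\widehat M_{R,0}=C_R^TM_{R,0}C_R ,$$ leaving all other blocks unchanged. (1) Every positive semidefinite choice of the original blocks gives positive semidefinite compressed blocks, and $\mathcal B_kT(S)=\widehat{\mathcal B}_k(S)$ for every nonempty $S\in I_k$. (2) Conversely, for every positive semidefinite choice of the compressed blocks, the matrices $M_{R,0}=J_R\widehat M_{R,0}J_R^T$ (for nonempty $R\in\mathcal R_{k-2}$) are positive semidefinite, and together with the other, unchanged blocks they satisfy $\mathcal B_kT(S)=\widehat{\mathcal B}_k(S)$ for every nonempty $S\in I_k$. (3) Consequently, the degree-zero block of a nonempty reference type $R$ with $m=|R|$ may be taken of order $q_R+1\le s^m+1$ with exactly the same feasible objective values: a real number $\alpha$ is a feasible objective value of the uncompressed problem if and only if it is a feasible objective value of the compressed problem.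
   Context: A spherical $\Lambda$-code is a finite subset of $S^{n-1}$ whose distinct points have inner products in $\Lambda$. $I_j$ is the collection of such codes of size at most $j$, including the empty set. Two codes have the same type if an orthogonal transformation carries one to the other (equivalently their Gram matrices agree up to simultaneous row and column permutation). $\mathcal R_{k-2}\subseteq I_{k-2}$ contains exactly one representative $R$ of each type with at most $k-2$ points. For each $R\in\mathcal R_{k-2}$ fix an ordering $r_1,\dots,r_m$, $m=|R|$, and put $A_R=[r_1\cdots r_m]$, $G_R=A_R^TA_R$, $\rho_i=G_Re_i$, $U_R^{\mathrm{gen}}=\{u\in\Lambda^m:1-u^TG_R^{-1}u\ge0\}$, $q_R=|U_R^{\mathrm{gen}}|$, $U_R=U_R^{\mathrm{gen}}\cup\{\rho_1,\dots,\rho_m\}$ (a disjoint union for $m\geq 1$; for $m=0$ both sets consist of one empty label). Original blocks: real symmetric matrices $M_{R,0}$ indexed by $U_R$ and, for $1\le l\le d$, $M_{R,l}$ indexed by $U_R^{\mathrm{gen}}$. Reference averaging: $S_R$ is the group of permutations $\sigma$ of $\{1,\dots,m\}$ with $P_\sigma^TG_RP_\sigma=G_R$, where $P_\sigma e_i=e_{\sigma(i)}$; put $(\widetilde M_{R,l})_{u,v}=\frac1{|S_R|}\sum_{\sigma\in S_R}(M_{R,l})_{P_\sigma^Tu,P_\sigma^Tv}$ (the label sets are stable under $u\mapsto P_\sigma^Tu$). Polynomials: with $G=G_R$, $p=n-m\ge2$, $h_u=1-u^TG^{-1}u$, $h_v=1-v^TG^{-1}v$, $w=t-u^TG^{-1}v$,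 set $P_0^{n,m}=1$, $P_1^{n,m}=w$, $P_l^{n,m}=\frac{(2l+p-4)wP_{l-1}^{n,m}-(l-1)h_uh_vP_{l-2}^{n,m}}{l+p-3}$ for $l\ge2$, evaluated at $(G;u,v,t)$ (for $m=0$: $h_u=h_v=1$, $w=t$). Union values: for a code $S\in I_k$, a subset $Q\subseteq S$ with $|Q|\le k-2$ of type $R$, and $x,y\in S$, order $Q$ so that the matrix $A_Q$ of its points satisfies $A_Q^TA_Q=G_R$, and put $$T(x,y,Q)=\sum_{l=0}^dP_l^{n,|Q|}(G_R;A_Q^Tx,A_Q^Ty,x\cdot y)\,(\widetilde M_{R,l})_{A_Q^Tx,A_Q^Ty},$$ where terms with $l>0$ are $0$ if $x\in Q$ or $y\in Q$ (the value does not depend on the chosen admissible ordering). For nonempty $S\in I_k$, $$\mathcal B_kT(S)=\sum_{Q\subseteq S,\ |Q|\le k-2}\ \ \sum_{(x,y)\in S^2,\ Q\cup\{x,y\}=S}T(x,y,Q).$$ Compression maps (nonempty $R$, reference labels ordered first): $C_R=\begin{pmatrix}\mathbf 1_m&0\\0&I_{q_R}\end{pmatrix}\in\mathbb R^{(m+q_R)\times(q_R+1)}$ with $\mathbf 1_m$ the all-ones column, $D_R=C_R^TC_R=\operatorname{diag}(m,I_{q_R})$, $J_R=C_RD_R^{-1}$. Compressed blocks: a symmetric matrix $\widehat M_{R,0}$ of order $q_R+1$ indexed by $\{0\}\sqcup U_R^{\mathrm{gen}}$ for each nonempty $R$ (the index $0$ is the combined reference index), together with the blocks $M_{R,l}$,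 $l\ge1$, for all $R$ and the scalar block $M_{\varnothing,0}$, which are not changed. Compressed union values: $\widehat{\mathcal B}_k(S)$ is obtained from $\mathcal B_kT(S)$ by keeping all positive-degree ($l\ge1$) contributions and the contribution of $Q=\varnothing$, and replacing, for each nonempty $Q\subseteq S$ with $|Q|\le k-2$ of type $R$, the total degree-zero ($l=0$) contribution of $Q$ by the average, over all $|S_R|$ orderings of $Q$ with $A_Q^TA_Q=G_R$, of the quantity: $(\widehat M_{R,0})_{0,0}$ if $S=Q$; $(\widehat M_{R,0})_{u,u}+2(\widehat M_{R,0})_{0,u}$ if $S\setminus Q=\{x\}$, with $u=A_Q^Tx$; $2(\widehat M_{R,0})_{u,v}$ if $S\setminus Q=\{x,y\}$ with $x\ne y$, $u=A_Q^Tx$, $v=A_Q^Ty$; and $0$ if $|S\setminus Q|>2$. Problems: $\alpha\in\mathbb R$ is a feasible objective value of the uncompressed (respectively compressed) problem if there are positive semidefinite original (respectively compressed) blocks such that for every nonempty $S\in I_k$ the value $\mathcal B_kT(S)$ (respectively $\widehat{\mathcal B}_k(S)$) is at most $\alpha-1$ if $|S|=1$, at most $-2$ if $|S|=2$, and at most $0$ if $3\le|S|\le k$. *)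

(* Defs.v *)
From HB Require Import structures.
From mathcomp Require Import all_boot all_order all_algebra all_fingroup.
From mathcomp Require Import finmap.
From mathcomp Require Import boolp classical_sets reals.

Set Implicit Arguments.
Unset Strict Implicit.
Unset Printing Implicit Defensive.

Import Order.TTheory GRing.Theory Num.Theory.
Local Open Scope fset_scope.
Local Open Scope ring_scope.

Section Codes.
Context {R : realType} {n : nat}.
Implicit Types (Lambda : {fset R}) (S X Q : {fset 'cV[R]_n}) (x y : 'cV[R]_n).

Definition dotv x y : R := (x^T *m y) 0 0.

Definition spherical_code Lambda S : Prop :=
  (forall x, x \in S -> dotv x x = 1) /\
  (forall x y, x \in S -> y \in S -> x != y -> dotv x y \in Lambda).

(* I_j *)
Definition codes Lambda (j : nat) S : Prop :=
  spherical_code Lambda S /\ (#|` S| <= j)%N.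

Definition same_type X Q : Prop :=
  exists2 O : 'M[R]_n, O^T *m O = 1%:M & [fset O *m x | x in X] = Q.

Definition type_representatives Lambda (j : nat) (reps : set {fset 'cV[R]_n}) :
    Prop :=
  (forall X, reps X -> codes Lambda j X) /\
  (forall Q, codes Lambda j Q -> exists! X, reps X /\ same_type X Q).

(* The representative of the type of Q; the default fset0 is returned only when
   the type of Q is not represented. *)
Definition rep (reps : set {fset 'cV[R]_n}) Q : {fset 'cV[R]_n} :=
  xget fset0 [set X | reps X /\ same_type X Q]%classic.

Definition lin_indep S : Prop := free (enum_fset S).

Definition points_mx Q (m : nat) (f : {ffun 'I_m -> Q}) : 'M[R]_(n, m) :=
  \matrix_(i, j) (fsval (f j)) i 0.

End Codes.

(* One ordering r_1, ..., r_m of every X; only the values at the representatives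
   matter, where r X is required to be injective, hence bijective. *)
Definition enumeration (R : realType) (n : nat) : Type :=
  forall X : {fset 'cV[R]_n}, {ffun 'I_#|` X| -> X}.

Definition psdmx {R : realType} {N : nat} (M : 'M[R]_N) : Prop :=
  M^T = M /\ forall c : 'cV[R]_N, 0 <= (c^T *m M *m c) 0 0.

(* M_{a,b} for positions a, b; None stands for a vector that is not a label. *)
Definition entry {R : realType} {N : nat} (M : 'M[R]_N) (a b : option 'I_N) : R :=
  if a is Some i then if b is Some j then M i j else 0 else 0.

Section Polynomials.
Context {R : realType} (n m : nat) (G : 'M[R]_m).
Implicit Types u v : 'cV[R]_m.

Definition slack u : R := 1 - (u^T *m invmx G *m u) 0 0.

Definition wval u v (t : R) : R := t - (u^T *m invmx G *m v) 0 0.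

Fixpoint Ppoly (l : nat) u v (t : R) : R :=
  let p : R := n%:R - m%:R in
  if l is l1.+1 then
    if l1 is l2.+1 then
      ((2 * l%:R + p - 4) * wval u v t * Ppoly l1 u v t
        - (l%:R - 1) * slack u * slack v * Ppoly l2 u v t)
      / (l%:R + p - 3)
    else wval u v t
  else 1.

(* P_sigma e_i = e_(sigma i); this is the transpose of perm_mx sigma. *)
Definition Pmx (sigma : 'S_m) : 'M[R]_m := \matrix_(i, j) (i == sigma j)%:R.

Definition gram_stab : {set 'S_m} :=
  [set sigma | (Pmx sigma)^T *m G *m Pmx sigma == G].

Definition ref_average (F : 'cV[R]_m -> 'cV[R]_m -> R) u v : R :=
  (#|gram_stab|%:R)^-1 *
  \sum_(sigma in gram_stab) F ((Pmx sigma)^T *m u) ((Pmx sigma)^T *m v).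

End Polynomials.

Section Blocks.
Context {R : realType} {n : nat}.
Variables (Lambda : {fset R}) (r : enumeration R n).
Implicit Types (S X Q : {fset 'cV[R]_n}) (x y : 'cV[R]_n).

Definition gram X : 'M[R]_(#|` X|) := (points_mx (r X))^T *m points_mx (r X).

(* U_X^gen, a set of vectors in Lambda^m *)
Definition Ugen X : {fset 'cV[R]_(#|` X|)} :=
  [fset u in [seq \col_i fsval (f i) | f : {ffun 'I_#|` X| -> Lambda}]
     | 0 <= slack (gram X) u].

Definition q X : nat := #|` Ugen X|.

Definition gen_label X (j : 'I_(q X)) : 'cV[R]_(#|` X|) :=
  (enum_fset (Ugen X))`_j.

(* The labels U_X listed as rho_1, ..., rho_m followed by U_X^gen.  For m > 0
   this lists a disjoint union; for m = 0 the only label is the empty vector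
   and it is listed once, as an element of U_X^gen. *)
Definition label X (i : 'I_(#|` X| + q X)) : 'cV[R]_(#|` X|) :=
  match split i with
  | inl i1 => col i1 (gram X)
  | inr j => gen_label j
  end.

Definition idx X (u : 'cV[R]_(#|` X|)) : option 'I_(#|` X| + q X) :=
  [pick i | label i == u].

Definition gen_idx X (u : 'cV[R]_(#|` X|)) : option 'I_(q X) :=
  [pick j | gen_label j == u].

(* Only the blocks at representatives X, and for blkpos the degrees
   1 <= l <= d, are used. *)
Record blocks : Type := Blocks {
  blk0 : forall X, 'M[R]_(#|` X| + q X);
  blkpos : forall X, nat -> 'M[R]_(q X) }.

(* cblk0 X is used for nonempty X only (row 0 is the combined reference index,
   the generic labels follow); cblk_empty is the scalar block M_(empty,0). *)
Record cblocks : Type := CBlocks {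
  cblk0 : forall X, 'M[R]_(1 + q X);
  cblk_empty : 'M[R]_(#|` @fset0 'cV[R]_n| + q fset0);
  cblkpos : forall X, nat -> 'M[R]_(q X) }.

Definition psd_blocks (reps : set {fset 'cV[R]_n}) (d : nat) (B : blocks) :
    Prop :=
  (forall X, reps X -> psdmx (blk0 B X)) /\
  (forall X l, reps X -> (1 <= l <= d)%N -> psdmx (blkpos B X l)).

Definition psd_cblocks (reps : set {fset 'cV[R]_n}) (d : nat) (B : cblocks) :
    Prop :=
  [/\ forall X, reps X -> X != fset0 -> psdmx (cblk0 B X),
      psdmx (cblk_empty B)
    & forall X l, reps X -> (1 <= l <= d)%N -> psdmx (cblkpos B X l)].

Definition Cmx X : 'M[R]_(#|` X| + q X, 1 + q X) :=
  block_mx (const_mx 1) 0 0 1%:M.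

Definition Dmx X : 'M[R]_(1 + q X) := (Cmx X)^T *m Cmx X.

Definition Jmx X : 'M[R]_(#|` X| + q X, 1 + q X) := Cmx X *m invmx (Dmx X).

Definition compress (B : blocks) : cblocks := {|
  cblk0 := fun X => (Cmx X)^T *m blk0 B X *m Cmx X;
  cblk_empty := blk0 B fset0;
  cblkpos := blkpos B |}.

(* conform_mx only transports cblk_empty to the type indexed by X = fset0. *)
Definition expand (B : cblocks) : blocks := {|
  blk0 := fun X => if X == fset0 then conform_mx 0 (cblk_empty B)
                   else Jmx X *m cblk0 B X *m (Jmx X)^T;
  blkpos := cblkpos B |}.

Lemma expand_empty (B : cblocks) : blk0 (expand B) fset0 = cblk_empty B.
Proof. by rewrite /expand /blk0 eqxx conform_mx_id. Qed.

(* The orderings of Q, a code of type X, with Gram matrix G_X *)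
Definition orderings X Q : {set {ffun 'I_#|` X| -> Q}} :=
  [set f : {ffun 'I_#|` X| -> Q} |
    [&& #|` Q| == #|` X|, injectiveb f
      & (points_mx f)^T *m points_mx f == gram X]].

(* The degree l term of T(x,y,Q), for Q of type X and for F giving the entries
   of the degree l block by labels; the admissible ordering of Q is picked
   arbitrarily. *)
Definition Tterm X (F : 'cV[R]_(#|` X|) -> 'cV[R]_(#|` X|) -> R) (l : nat) x y Q :
    R :=
  if (0 < l)%N && ((x \in Q) || (y \in Q)) then 0
  else if [pick f in orderings X Q] is Some f then
    let A := points_mx f in
    Ppoly n (gram X) l (A^T *m x) (A^T *m y) (dotv x y)
    * ref_average (gram X) F (A^T *m x) (A^T *m y)
  else 0.

Definition ent0 X (M : 'M[R]_(#|` X| + q X)) (u v : 'cV[R]_(#|` X|)) : R :=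
  entry M (idx u) (idx v).

Definition entpos X (M : 'M[R]_(q X)) (u v : 'cV[R]_(#|` X|)) : R :=
  entry M (gen_idx u) (gen_idx v).

Section UnionValues.
Variables (reps : set {fset 'cV[R]_n}) (k d : nat).

Definition Tval (B : blocks) x y Q : R :=
  let X := rep reps Q in
  \sum_(0 <= l < d.+1)
    Tterm (if l == 0%N then ent0 (blk0 B X) else entpos (blkpos B X l)) l x y Q.

Definition union_value (B : blocks) S : R :=
  \sum_(Q <- fpowerset S | (#|` Q| <= k - 2)%N)
    \sum_(x <- S) \sum_(y <- S | Q `|` [fset x; y] == S) Tval B x y Q.

(* The degree zero quantity attached to an ordering f of Q *)
Definition cquantity X Q (M : 'M[R]_(1 + q X)) (f : {ffun 'I_#|` X| -> Q}) S : R :=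
  let zero : option 'I_(1 + q X) := Some (lshift (q X) ord0) in
  let pos x := omap (@rshift 1 (q X)) (gen_idx ((points_mx f)^T *m x)) in
  match enum_fset (S `\` Q) with
  | [::] => entry M zero zero
  | [:: x] => entry M (pos x) (pos x) + 2 * entry M zero (pos x)
  | [:: x; y] => 2 * entry M (pos x) (pos y)
  | _ => 0
  end.

Definition cdegree0 (B : cblocks) S Q : R :=
  if Q == fset0 then
    \sum_(x <- S) \sum_(y <- S | Q `|` [fset x; y] == S)
      Tterm (ent0 (cblk_empty B)) 0 x y fset0
  else
    let X := rep reps Q in
    (#|orderings X Q|%:R)^-1 *
    \sum_(f in orderings X Q) cquantity (cblk0 B X) f S.

Definition cunion_value (B : cblocks) S : R :=
  \sum_(Q <- fpowerset S | (#|` Q| <= k - 2)%N)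
    (cdegree0 B S Q +
     \sum_(x <- S) \sum_(y <- S | Q `|` [fset x; y] == S)
       \sum_(1 <= l < d.+1)
         Tterm (entpos (cblkpos B (rep reps Q) l)) l x y Q).

Definition rhs (alpha : R) (j : nat) : R :=
  if j == 1%N then alpha - 1 else if j == 2 then - 2 else 0.

Definition feasible (alpha : R) : Prop :=
  exists2 B : blocks, psd_blocks reps d B &
    forall S, codes Lambda k S -> S != fset0 ->
      union_value B S <= rhs alpha #|` S|.

Definition cfeasible (alpha : R) : Prop :=
  exists2 B : cblocks, psd_cblocks reps d B &
    forall S, codes Lambda k S -> S != fset0 ->
      cunion_value B S <= rhs alpha #|` S|.

End UnionValues.
End Blocks.

(* Main.v *)
Require Import Defs.
From HB Require Import structures.
From mathcomp Require Import all_boot all_order all_algebra all_fingroup.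
From mathcomp Require Import finmap.
From mathcomp Require Import boolp classical_sets reals.

Set Implicit Arguments.
Unset Strict Implicit.
Unset Printing Implicit Defensive.

Import Order.TTheory GRing.Theory Num.Theory.
Local Open Scope fset_scope.
Local Open Scope ring_scope.

(* Averaging a degree-zero block over the stabilizer of the Gram matrix is the
   same as averaging its entries over all admissible orderings of Q.  For a
   fixed ordering, the pairs (x, y) with Q u {x, y} = S see the reference labels
   only through full sums over these labels, that is, through C^T M C.  Hence
   compression preserves all union values, and C^T J = 1 gives the converse.
   Linear independence enters through the slack: 1 - u^T G^-1 u is the squared
   distance from x to the span of Q, so that the points of S \ Q really have
   generic labels. *)

(** * Gram matrices of enumerated point sets and their invertibility *)

Section Gram.
Context {R : realType} {n : nat}.
Implicit Types (Q : {fset 'cV[R]_n}) (x y : 'cV[R]_n).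

Lemma dotvv_sum x : dotv x x = \sum_i x i 0 ^+ 2.
Proof. by rewrite /dotv mxE; apply: eq_bigr => i _; rewrite mxE expr2. Qed.

Lemma dotvv_ge0 x : 0 <= dotv x x.
Proof. by rewrite dotvv_sum sumr_ge0 // => i _; rewrite sqr_ge0. Qed.

Lemma dotvv_eq0 x : dotv x x = 0 -> x = 0.
Proof.
rewrite dotvv_sum => /eqP; rewrite psumr_eq0 => [/allP x0|i _]; last exact: sqr_ge0.
apply/matrixP => i j; rewrite ord1 mxE.
by apply/eqP; rewrite -sqrf_eq0; apply: x0; rewrite mem_index_enum.
Qed.

Lemma points_mx_trE Q m (f : {ffun 'I_m -> Q}) x i :
  ((points_mx f)^T *m x) i 0 = dotv (fsval (f i)) x.
Proof.
by rewrite /dotv !mxE; apply: eq_bigr => j _; rewrite !mxE.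
Qed.

Lemma points_mx_gramE Q m (f : {ffun 'I_m -> Q}) i j :
  ((points_mx f)^T *m points_mx f) i j = dotv (fsval (f i)) (fsval (f j)).
Proof.
by rewrite /dotv !mxE; apply: eq_bigr => l _; rewrite !mxE.
Qed.

Lemma col_points_mx_gram Q m (f : {ffun 'I_m -> Q}) i :
  col i ((points_mx f)^T *m points_mx f) = (points_mx f)^T *m fsval (f i).
Proof.
by apply/matrixP => a b; rewrite ord1 mxE points_mx_gramE points_mx_trE.
Qed.

Lemma perm_enum_ordering Q m (f : {ffun 'I_m -> Q}) :
  injective f -> #|` Q| = m ->
  perm_eq (enum_fset Q) [seq fsval (f i) | i <- enum 'I_m].
Proof.
move=> f_inj cardQ.
have uf : uniq [seq fsval (f i) | i <- enum 'I_m].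
  by rewrite map_inj_uniq ?enum_uniq // => i j /val_inj /f_inj.
rewrite perm_sym; apply: uniq_perm => //.
have [] := uniq_min_size uf (s2 := enum_fset Q).
- by move=> x /mapP[i _ ->]; apply: fsvalP.
- by rewrite size_map size_enum_ord -cardQ.
- by [].
Qed.

Lemma big_ordering Q m (f : {ffun 'I_m -> Q}) (h : 'cV[R]_n -> R) :
  injective f -> #|` Q| = m ->
  \sum_(x <- Q) h x = \sum_i h (fsval (f i)).
Proof.
move=> f_inj cardQ; rewrite (perm_big _ (perm_enum_ordering f_inj cardQ)) /=.
by rewrite big_map big_enum.
Qed.

(** Write [A] for [points_mx f]. A row vector [v] killed by the Gram matrix [G] satisfies
    [|A v^T|^2 = v G v^T = 0], so [A v^T = 0] is a linear relation among the points of [Q]. *)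
Lemma points_mx_gram_unit Q m (f : {ffun 'I_m -> Q}) :
  injective f -> #|` Q| = m -> lin_indep Q ->
  (points_mx f)^T *m points_mx f \in unitmx.
Proof.
move=> f_inj cardQ freeQ; rewrite -row_free_unit; apply: inj_row_free => v vG0.
have Av0 : points_mx f *m v^T = 0.
  apply: dotvv_eq0; rewrite /dotv trmx_mul trmxK !mulmxA.
  by rewrite -(mulmxA v) vG0 mul0mx mxE.
rewrite /lin_indep (perm_free (perm_enum_ordering f_inj cardQ)) in freeQ.
have st : size [seq fsval (f i) | i <- enum 'I_m] == m.
  by rewrite size_map size_enum_ord.
have /freeP freeT : free (Tuple st) by [].
apply/matrixP => i j; rewrite ord1 [RHS]mxE {i}.
apply: (freeT (fun i => v 0 i)).
apply/matrixP => a b; rewrite ord1 summxE.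
transitivity ((points_mx f *m v^T) a 0); last by rewrite Av0.
rewrite mxE; apply: eq_bigr => i _.
by rewrite !mxE (nth_map i) ?size_enum_ord // nth_ord_enum mulrC.
Qed.

(* Pythagoras for the orthogonal projection onto the span of the columns. *)
Lemma slack_points_mx_ge0 Q m (f : {ffun 'I_m -> Q}) x :
  (points_mx f)^T *m points_mx f \in unitmx -> dotv x x = 1 ->
  0 <= slack ((points_mx f)^T *m points_mx f) ((points_mx f)^T *m x).
Proof.
set A := points_mx f; set G := A^T *m A => Gu x1.
pose z := x - A *m invmx G *m A^T *m x.
suff -> : slack G (A^T *m x) = dotv z z by exact: dotvv_ge0.
have GT : (invmx G)^T = invmx G by rewrite trmx_inv trmx_mul trmxK.
have zA0 : z^T *m A = 0.
  apply: trmx_inj; rewrite trmx_mul trmxK trmx0 mulmxBr !mulmxA mulmxV //.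
  by rewrite mul1mx subrr.
rewrite /slack -x1 /dotv {2}/z mulmxBr !mulmxA zA0 !mul0mx subr0.
rewrite /z linearB /= mulmxBl !trmx_mul !trmxK GT !mulmxA.
by rewrite [RHS]mxE [X in _ = _ + X]mxE.
Qed.

End Gram.

(** * Admissible orderings as an orbit of the Gram stabilizer *)

Section Orderings.
Context {R : realType} {n : nat} (r : enumeration R n).
Implicit Types (X Q : {fset 'cV[R]_n}).

Lemma orderingsP X Q (f : {ffun 'I_#|` X| -> Q}) : f \in orderings r X Q ->
  [/\ #|` Q| = #|` X|, injective f & (points_mx f)^T *m points_mx f = gram r X].
Proof. by rewrite inE => /and3P[/eqP ? /injectiveP ? /eqP]. Qed.

Lemma points_mxM_Pmx Q m (f : {ffun 'I_m -> Q}) (s : 'S_m) :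
  points_mx f *m Pmx s = points_mx [ffun i => f (s i)].
Proof.
apply/matrixP => i j; rewrite !mxE (bigD1 (s j)) //= !mxE ffunE eqxx mulr1.
by rewrite big1 ?addr0 // => l /negPf lj; rewrite !mxE lj mulr0.
Qed.

(** Two admissible orderings [f] and [g] differ by the permutation [f^-1 g]; as both have the same
    Gram matrix, that permutation stabilizes it. *)
Lemma orderings_gram_stab X Q (f : {ffun 'I_#|` X| -> Q}) :
  f \in orderings r X Q ->
  orderings r X Q =
  [set [ffun i => f ((s : 'S__) i)] | s in gram_stab (gram r X)].
Proof.
move=> fo; have [cQ f_inj fG] := orderingsP fo.
apply/setP => g; apply/idP/imsetP => [go|[s]].
  have [_ g_inj gG] := orderingsP go.
  have cardE : #|{: 'I_(#|` X|)}| = #|{: Q}| by rewrite card_ord -cardfE.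
  have [f' fK f'K] : bijective f by apply: inj_card_bij; rewrite ?cardE.
  have s_inj : injective (f' \o g) by apply: inj_comp => //; apply: can_inj f'K.
  have gE : g = [ffun i => f (perm s_inj i)].
    by apply/ffunP => i; rewrite ffunE permE /= f'K.
  exists (perm s_inj) => //; rewrite inE -fG !mulmxA -trmx_mul -mulmxA.
  by rewrite points_mxM_Pmx -gE fG gG.
rewrite inE => /eqP sG ->; rewrite inE cQ eqxx /=; apply/andP; split.
  apply/injectiveP => i j; rewrite !ffunE => /f_inj; exact: perm_inj.
by rewrite -points_mxM_Pmx trmx_mul mulmxA -(mulmxA (Pmx s)^T) fG sG.
Qed.

(** The right-hand side does not depend on [f], so the arbitrary choice of an ordering in [Tterm] is
    harmless. *)
Lemma ref_average_orderings X Q (f : {ffun 'I_#|` X| -> Q}) F x y :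
  f \in orderings r X Q ->
  ref_average (gram r X) F ((points_mx f)^T *m x) ((points_mx f)^T *m y) =
  (#|orderings r X Q|%:R)^-1 * \sum_(g in orderings r X Q)
    F ((points_mx g)^T *m x) ((points_mx g)^T *m y).
Proof.
move=> fo; have [_ f_inj _] := orderingsP fo.
(* Distinct permutations give distinct orderings, so the two normalizing factors agree. *)
have act_inj : injective (fun s : 'S_#|` X| => [ffun i => f (s i)]).
  by move=> s t /ffunP st; apply/permP => i; have := st i; rewrite !ffunE => /f_inj.
rewrite /ref_average (orderings_gram_stab fo) card_imset // big_imset /=; last first.
  by move=> s t _ _ /act_inj.
congr (_ * _); apply: eq_bigr => s _.
by rewrite !mulmxA -trmx_mul points_mxM_Pmx.
Qed.

(** An orthogonal map preserves inner products, so it carries the fixed ordering of [X] to an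
    admissible one of [Q]. This rules out a failed [pick] in [Tterm]. *)
Lemma orderings_neq0 X Q :
  injective (r X) -> same_type X Q -> exists f, f \in orderings r X Q.
Proof.
move=> r_inj [O OO XQ].
have O_inj : injective (fun x : 'cV[R]_n => O *m x).
  by move=> x y /(congr1 (mulmx O^T)); rewrite !mulmxA OO !mul1mx.
have OQ i : O *m fsval (r X i) \in Q.
  by rewrite -XQ; apply/imfsetP; exists (fsval (r X i)) => //; apply: fsvalP.
exists [ffun i => [` OQ i]]; rewrite inE; apply/and3P; split.
- by rewrite -XQ card_imfset.
- apply/injectiveP => i j; rewrite !ffunE => /(congr1 val) /= /O_inj /val_inj.
  exact: r_inj.
- apply/eqP/matrixP => i j; rewrite points_mx_gramE !ffunE /= /dotv.
  rewrite trmx_mul mulmxA -(mulmxA _ _ O) OO mulmx1.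
  by rewrite /gram points_mx_gramE.
Qed.

End Orderings.

(** * Labels of points: reference points against generic points *)

Section Labels.
Context {R : realType} {n : nat} {Lambda : {fset R}} (r : enumeration R n).
Hypothesis Lambda_range : forall a, a \in Lambda -> -1 <= a < 1.
Context {X Q S : {fset 'cV[R]_n}} (f : {ffun 'I_#|` X| -> Q}).
Hypothesis f_ord : f \in orderings r X Q.
Hypothesis codeS : spherical_code Lambda S.
Hypothesis sQS : Q `<=` S.
Hypothesis indepQ : lin_indep Q.
Local Notation coordv x := ((points_mx f)^T *m x).

Lemma ordering_in i : fsval (f i) \in S.
Proof. by apply: (fsubsetP sQS); apply: fsvalP. Qed.

Lemma in_Ugen (u : 'cV[R]_#|` X|) : (u \in Ugen Lambda r X) =
  (u \in [seq \col_i fsval (g i) | g : {ffun 'I_#|` X| -> Lambda}])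
  && (0 <= slack (gram r X) u).
Proof. by rewrite !inE. Qed.

Lemma Ugen_coord (u : 'cV[R]_#|` X|) i : u \in Ugen Lambda r X -> u i 0 \in Lambda.
Proof.
rewrite in_Ugen => /andP[/mapP[g _ ->] _].
by rewrite mxE; apply: fsvalP.
Qed.

(** Coordinates are inner products of distinct points of [S], hence lie in [Lambda]; independence of
    [Q] makes the Gram matrix invertible, as the slack bound requires. *)
Lemma coordv_Ugen x : x \in S -> x \notin Q -> coordv x \in Ugen Lambda r X.
Proof.
have [cQ f_inj fG] := orderingsP f_ord.
have [S1 SL] := codeS.
move=> xS xQ.
have xL i : (coordv x) i 0 \in Lambda.
  rewrite points_mx_trE; apply: SL => //; first exact: ordering_in.
  by apply: contraNneq xQ => <-; apply: fsvalP.
rewrite in_Ugen; apply/andP; split.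
  apply/mapP; exists [ffun i => [` xL i]]; first exact: mem_enum.
  by apply/matrixP => i j; rewrite ord1 [RHS]mxE ffunE.
rewrite -fG slack_points_mx_ge0 ?S1 //; exact: points_mx_gram_unit.
Qed.

Lemma gen_label_in (j : 'I_(q Lambda r X)) : gen_label j \in Ugen Lambda r X.
Proof. by rewrite /gen_label mem_nth. Qed.

Lemma gen_label_inj : injective (@gen_label _ _ Lambda r X).
Proof.
move=> i j /eqP; rewrite /gen_label nth_uniq ?fset_uniq // => /eqP ij.
exact: val_inj.
Qed.

Lemma gen_idxK (j : 'I_(q Lambda r X)) : gen_idx Lambda r (gen_label j) = Some j.
Proof.
rewrite /gen_idx; case: pickP => [i /eqP/gen_label_inj -> //|/(_ j)].
by rewrite eqxx.
Qed.

Lemma gram_diag i : gram r X i i = 1.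
Proof.
have [_ _ <-] := orderingsP f_ord.
by rewrite points_mx_gramE; have [-> //] := codeS; apply: ordering_in.
Qed.

Lemma gram_offdiag i j : i != j -> gram r X i j \in Lambda.
Proof.
have [_ f_inj <-] := orderingsP f_ord => ij.
rewrite points_mx_gramE; have [_] := codeS; apply; try exact: ordering_in.
by apply: contraNneq ij => /val_inj /f_inj ->.
Qed.

(** The column [rho_i] has diagonal coordinate 1, whereas off-diagonal Gram entries and coordinates
    of generic labels lie in [Lambda], hence are below 1. Thus [idx] recovers positions
    unambiguously. *)
Lemma label_inj : injective (@label _ _ Lambda r X).
Proof.
have lt1 a : a \in Lambda -> a != 1.
  by move=> /Lambda_range /andP[_]; rewrite lt_neqAle => /andP[].
have colgen i j : col i (gram r X) <> gen_label (j : 'I_(q Lambda r X)).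
  move=> E; have := lt1 _ (Ugen_coord i (gen_label_in j)).
  by rewrite -E mxE gram_diag eqxx.
move=> a b; rewrite /label.
case: (splitP a) => i ai; case: (splitP b) => j bj.
- move=> E; apply: val_inj => /=; rewrite ai bj.
  have [-> //|/gram_offdiag /lt1] := eqVneq i j.
  have : col i (gram r X) i 0 = col j (gram r X) i 0 by rewrite E.
  by rewrite mxE [RHS]mxE gram_diag => <-; rewrite eqxx.
- by move/colgen.
- by move/esym/colgen.
- by move/gen_label_inj => ij; apply: val_inj => /=; rewrite ai bj ij.
Qed.

Lemma idx_label (a : 'I_(#|` X| + q Lambda r X)) : idx Lambda r (label a) = Some a.
Proof.
rewrite /idx; case: pickP => [i /eqP/label_inj -> //|/(_ a)].
by rewrite eqxx.
Qed.

Lemma idx_ordering i : idx Lambda r (coordv (fsval (f i))) = Some (lshift _ i).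
Proof.
have [_ _ fG] := orderingsP f_ord.
rewrite -col_points_mx_gram fG -idx_label; congr idx.
by rewrite /label (unsplitK (inl i)).
Qed.

(** One [j] must serve both lookups: [cquantity] uses [gen_idx], while the original block uses
    [idx], where generic labels follow the reference ones. *)
Lemma idx_generic x : x \in S -> x \notin Q -> exists2 j,
  gen_idx Lambda r (coordv x) = Some j &
  idx Lambda r (coordv x) = Some (rshift _ j).
Proof.
move=> xS xQ; have xU := coordv_Ugen xS xQ.
have jq : (index (coordv x) (enum_fset (Ugen Lambda r X)) < q Lambda r X)%N.
  by rewrite index_mem.
have [j E] : exists j : 'I_(q Lambda r X), coordv x = gen_label j.
  by exists (Ordinal jq); rewrite /gen_label nth_index.
exists j; rewrite E ?gen_idxK // -idx_label; congr idx.
by rewrite /label (unsplitK (inr j)).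
Qed.

End Labels.

(** * Congruence by the compression matrices *)

Lemma psdmx_conj {R : realType} p N (M : 'M[R]_p) (C : 'M[R]_(p, N)) :
  psdmx M -> psdmx (C^T *m M *m C).
Proof.
move=> [MT M0]; split; first by rewrite !trmx_mul trmxK MT mulmxA.
by move=> c; have := M0 (C *m c); rewrite trmx_mul !mulmxA.
Qed.

Section Compression.
Context {R : realType} {n : nat} {Lambda : {fset R}} {r : enumeration R n}.
Context {X : {fset 'cV[R]_n}}.
Local Notation m := #|` X|.
Local Notation qX := (q Lambda r X).
Local Notation C := (Cmx Lambda r X).

Lemma compress_block (M : 'M[R]_(m + qX)) :
  C^T *m M *m C =
  block_mx ((const_mx 1)^T *m ulsubmx M *m const_mx 1)
           ((const_mx 1)^T *m ursubmx M)
           (dlsubmx M *m const_mx 1) (drsubmx M).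
Proof.
rewrite -{1}(submxK M) /Cmx tr_block_mx !trmx0 trmx1 !mulmx_block.
by rewrite !(mul0mx, mulmx0, mul1mx, mulmx1, add0r, addr0).
Qed.

Lemma compress00 (M : 'M[R]_(m + qX)) :
  (C^T *m M *m C) (lshift qX ord0) (lshift qX ord0) =
  \sum_i \sum_j M (lshift qX i) (lshift qX j).
Proof.
rewrite compress_block block_mxEul mxE exchange_big; apply: eq_bigr => j _ /=.
by rewrite !mxE mulr1; apply: eq_bigr => i _; rewrite !mxE mul1r.
Qed.

Lemma compress0r (M : 'M[R]_(m + qX)) v :
  (C^T *m M *m C) (lshift qX ord0) (rshift 1 v) =
  \sum_i M (lshift qX i) (rshift m v).
Proof.
rewrite compress_block block_mxEur mxE; apply: eq_bigr => j _ /=.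
by rewrite !mxE mul1r.
Qed.

Lemma compressrr (M : 'M[R]_(m + qX)) u v :
  (C^T *m M *m C) (rshift 1 u) (rshift 1 v) = M (rshift m u) (rshift m v).
Proof. by rewrite compress_block block_mxEdr !mxE. Qed.

(** [Dmx] is block diagonal with blocks [m] and the identity, so its determinant is [m], nonzero
    because [X] is nonempty. *)
Lemma Dmx_unit : X != fset0 -> Dmx Lambda r X \in unitmx.
Proof.
move=> X0; rewrite /Dmx /Cmx tr_block_mx !trmx0 trmx1 mulmx_block.
rewrite !(mul0mx, mulmx0, mul1mx, mulmx1, add0r, addr0).
rewrite unitmxE det_ublock det1 mulr1 det_mx11 mxE.
under eq_bigr do rewrite !mxE mulr1.
by rewrite sumr_const card_ord unitfE pnatr_eq0 cardfs_eq0.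
Qed.

(** Since [J] is [C] times the inverse of [C^T C], the product [C^T J] is the identity; transposing
    handles the other side. *)
Lemma compress_expand (M : 'M[R]_(1 + qX)) : X != fset0 ->
  let J := Jmx Lambda r X in C^T *m (J *m M *m J^T) *m C = M.
Proof.
move=> /Dmx_unit Du J.
have CJ : C^T *m J = 1%:M by rewrite /J /Jmx mulmxA mulmxV.
have JC : J^T *m C = 1%:M by rewrite -[C]trmxK -trmx_mul CJ trmx1.
(* mulmxA would otherwise reassociate inside the body of J. *)
clearbody J.
by rewrite !mulmxA CJ mul1mx -mulmxA JC mulmx1.
Qed.

End Compression.

(** * Pairs that complete [Q] to [S] *)

Section UnionSums.
Context {R : realType} {n : nat}.
Implicit Types (Q S : {fset 'cV[R]_n}).

Lemma perm_enum_fsetD Q S :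
  Q `<=` S -> perm_eq (enum_fset S) (enum_fset (S `\` Q) ++ enum_fset Q).
Proof.
move=> sQS; apply: uniq_perm => [||x]; rewrite ?fset_uniq //.
  rewrite cat_uniq !fset_uniq andbT /=; apply/hasPn => x /= xQ.
  by rewrite in_fsetD xQ.
rewrite mem_cat in_fsetD; case: (boolP (x \in Q)) => [/(fsubsetP sQS) ->|] //=.
by rewrite orbF.
Qed.

Lemma fsetU2_eq Q S x y : Q `<=` S -> x \in S -> y \in S ->
  (Q `|` [fset x; y] == S) = all (mem [:: x; y]) (enum_fset (S `\` Q)).
Proof.
move=> sQS xS yS; apply/eqP/allP => [<- z|sDxy].
  by rewrite /= !inE; case: (z \in Q).
apply/fsetP => z; rewrite !inE; apply/idP/idP => [/or3P[|/eqP->|/eqP->] //|zS].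
  exact: (fsubsetP sQS).
case: (boolP (z \in Q)) => //= zQ.
by have := sDxy z; rewrite /= !inE => -> //; rewrite zQ zS.
Qed.

(** Listing the points outside [Q] first turns the union condition into a test on that list alone,
    so that a case analysis on its length matches the branches of [cquantity]. *)
Lemma union_sumE Q S (F : 'cV[R]_n -> 'cV[R]_n -> R) : Q `<=` S ->
  let s := enum_fset (S `\` Q) in
  \sum_(x <- S) \sum_(y <- S | Q `|` [fset x; y] == S) F x y =
  \sum_(x <- s ++ enum_fset Q) \sum_(y <- s ++ enum_fset Q)
     if all (mem [:: x; y]) s then F x y else 0.
Proof.
move=> sQS s; rewrite big_seq_cond.
rewrite -(perm_big _ (perm_enum_fsetD sQS)) [RHS]big_seq_cond.
apply: eq_bigr => x /andP[xS _].
rewrite -(perm_big _ (perm_enum_fsetD sQS)) -big_mkcond.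
rewrite [LHS]big_seq_cond [RHS]big_seq_cond; apply: eq_bigl => y.
by case: (boolP (y \in _)) => //= yS; rewrite fsetU2_eq.
Qed.

End UnionSums.

(** * Degree-zero sums for one fixed ordering *)

Section DegreeZero.
Context {R : realType} {n : nat} {Lambda : {fset R}} (r : enumeration R n).
Hypothesis Lambda_range : forall a, a \in Lambda -> -1 <= a < 1.
Context {X Q S : {fset 'cV[R]_n}}.
Hypothesis codeS : spherical_code Lambda S.
Hypothesis sQS : Q `<=` S.
Hypothesis indepQ : lin_indep Q.

(** Case analysis on the number of points of [S] outside [Q]; symmetry of [M] merges the two orders
    of a mixed pair and produces the factors 2. *)
Lemma degree0_ordering (f : {ffun 'I_#|` X| -> Q})
    (M : 'M[R]_(#|` X| + q Lambda r X)) :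
  f \in orderings r X Q -> M^T = M ->
  \sum_(x <- S) \sum_(y <- S | Q `|` [fset x; y] == S)
    ent0 M ((points_mx f)^T *m x) ((points_mx f)^T *m y) =
  cquantity ((Cmx Lambda r X)^T *m M *m Cmx Lambda r X) f S.
Proof.
move=> f_ord MT; have [cQ f_inj _] := orderingsP f_ord.
have Msym i j : M i j = M j i by rewrite -[in LHS]MT mxE.
have sumQ (h : 'cV[R]_n -> R) : \sum_(x <- Q) h x = \sum_i h (fsval (f i)).
  exact: big_ordering.
have idxQ := idx_ordering Lambda_range f_ord codeS sQS.
have genP x : x \in enum_fset (S `\` Q) -> exists j,
    [/\ x \notin Q, gen_idx Lambda r ((points_mx f)^T *m x) = Some j &
        idx Lambda r ((points_mx f)^T *m x) = Some (rshift _ j)].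
  rewrite in_fsetD => /andP[xQ xS].
  by have [j] := idx_generic Lambda_range f_ord codeS sQS indepQ xS xQ; exists j.
rewrite union_sumE // /cquantity.
have := fset_uniq (S `\` Q); move: genP.
case: (enum_fset (S `\` Q)) => [_ _|z s genP].
  rewrite /= compress00 sumQ; apply: eq_bigr => i _.
  by rewrite sumQ; apply: eq_bigr => j _; rewrite /ent0 !idxQ.
have [zj [zQ zg zi]] := genP z (mem_head _ _).
have zf i : (z == fsval (f i)) = false.
  by apply: contraNF zQ => /eqP->; apply: fsvalP.
(* One outside point [z]: the pair (z, z) gives the diagonal entry, and the pairs joining [z] to
   [Q], in either order, give two equal reference sums. *)
case: s genP => [_ _|w s genP].
  rewrite zg /= compress0r compressrr !big_cons /= !inE eqxx /= !sumQ.
  rewrite -addrA; congr (_ + _); first by rewrite /ent0 zi.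
  rewrite mulr_natl mulr2n; congr (_ + _); apply: eq_bigr => i _.
    by rewrite !inE eqxx /ent0 zi idxQ Msym.
  rewrite big_cons !inE eqxx orbT /= sumQ big1 ?addr0 /ent0 ?zi ?idxQ //.
  by move=> j _; rewrite !inE !zf.
have /genP[wj [wQ wg wi]] : w \in [:: z, w & s] by rewrite !inE eqxx orbT.
have wf i : (w == fsval (f i)) = false.
  by apply: contraNF wQ => /eqP->; apply: fsvalP.
(* Exactly two outside points: only (z, w) and (w, z) cover both, and all other terms vanish. *)
case: s genP => [_|v s _].
  rewrite /= inE andbT => zw; rewrite zg wg /= compressrr.
  rewrite !big_cons /= !sumQ !inE !eqxx /= !(eq_sym w z) (negPf zw) /=.
  rewrite !big1; first 1 last; try move=> i _.
  - rewrite big1 // => y _; rewrite !inE zf wf /= andbT.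
    by case: eqP => // <-; rewrite eq_sym (negPf zw).
  - by rewrite !inE zf orbF (negPf zw).
  - by rewrite !inE wf orbF (eq_sym w z) (negPf zw) andbF.
  rewrite /ent0 zi wi /= add0r !addr0 (Msym (rshift _ wj)).
  by rewrite mulr_natl mulr2n.
(* Three or more distinct points cannot all lie among [x] and [y]. *)
move=> us; rewrite big1 // => x _; rewrite big1 // => y _.
by case: ifP => // /allP /(uniq_leq_size us).
Qed.

End DegreeZero.

(** * Representatives of types *)

Section Representatives.
Context {R : realType} {n j : nat} {Lambda : {fset R}}.
Context {reps : set {fset 'cV[R]_n}}.
Hypothesis reps_ok : type_representatives Lambda j reps.
Implicit Types Q S : {fset 'cV[R]_n}.

Lemma codes_sub Q S : spherical_code Lambda S -> Q `<=` S ->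
  (#|` Q| <= j)%N -> codes Lambda j Q.
Proof.
move=> [S1 SL] /fsubsetP sQS Qj; split=> //; split=> [x /sQS/S1 //|x y /sQS xS /sQS].
exact: SL.
Qed.

Lemma repP Q : codes Lambda j Q -> reps (rep reps Q) /\ same_type (rep reps Q) Q.
Proof.
move=> /(proj2 reps_ok) [X [XQ _]].
pose E := [set Y | reps Y /\ same_type Y Q]%classic.
exact: (@xgetPex _ fset0 E (ex_intro _ X XQ)).
Qed.

Lemma same_type_fset0 X : same_type X (@fset0 'cV[R]_n) -> X = fset0.
Proof.
move=> [O _ X0]; apply/eqP/fset0Pn => -[x xX].
have : O *m x \in [fset O *m y | y in X] by apply/imfsetP; exists x.
by rewrite X0 inE.
Qed.

(** The representative of the empty code has empty image, so it is itself empty. This matches the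
    scalar block [cblk_empty] with the block at [fset0]. *)
Lemma rep_fset0 : reps fset0 /\ rep reps fset0 = fset0.
Proof.
have [] : reps (rep reps fset0) /\ same_type (rep reps fset0) fset0.
  apply: repP; split; last by rewrite cardfs0.
  by split=> x; rewrite inE.
by move=> + /same_type_fset0 E; rewrite E.
Qed.

End Representatives.

(** Generic labels are distinct members of a list indexed by the functions from [m] positions to
    [Lambda]. *)
Lemma card_Ugen {R : realType} n (Lambda : {fset R}) (r : enumeration R n) X :
  (q Lambda r X <= #|` Lambda| ^ #|` X|)%N.
Proof.
pose s := [seq \col_i fsval (g i) | g : {ffun 'I_#|` X| -> Lambda}].
have -> : (#|` Lambda| ^ #|` X|)%N = size s.
  by rewrite size_map -cardE card_ffun card_ord -cardfE.
apply: uniq_leq_size; first exact: fset_uniq.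
by move=> u; rewrite in_Ugen => /andP[].
Qed.

(** * Comparison of union values and of feasibility *)

Section Comparison.
Context {R : realType} {n k d : nat} {Lambda : {fset R}}.
Context {reps : set {fset 'cV[R]_n}} {r : enumeration R n}.
Hypothesis Lambda_range : forall a, a \in Lambda -> -1 <= a < 1.
Hypothesis indep : forall S : {fset 'cV[R]_n}, codes Lambda (k - 2) S -> lin_indep S.
Hypothesis reps_ok : type_representatives Lambda (k - 2) reps.
Hypothesis r_ok : forall X, reps X -> injective (r X).
Implicit Types S Q : {fset 'cV[R]_n}.

Lemma degree0_contribution S Q (X := rep reps Q)
    (M : 'M[R]_(#|` X| + q Lambda r X)) :
  spherical_code Lambda S -> Q `<=` S -> (#|` Q| <= k - 2)%N -> M^T = M ->
  \sum_(x <- S) \sum_(y <- S | Q `|` [fset x; y] == S) Tterm r (ent0 M) 0 x y Q =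
  (#|orderings r X Q|%:R)^-1 * \sum_(f in orderings r X Q)
     cquantity ((Cmx Lambda r X)^T *m M *m Cmx Lambda r X) f S.
Proof.
move=> codeS sQS Qk MT; have codeQ := codes_sub codeS sQS Qk.
have [repX XQ] := repP reps_ok codeQ.
have [f0 f0_ord] := orderings_neq0 (r_ok repX) XQ.
have TE x y : Tterm r (ent0 M) 0 x y Q = (#|orderings r X Q|%:R)^-1 *
    \sum_(f in orderings r X Q)
      ent0 M ((points_mx f)^T *m x) ((points_mx f)^T *m y).
  (* [f0] excludes the default branch; the factor removed next is [Ppoly] in degree zero, which is
     1. *)
  rewrite /Tterm /=; case: pickP => [f f_ord|/(_ f0)]; last by rewrite f0_ord.
  by rewrite mul1r ref_average_orderings.
under eq_bigr do under eq_bigr do rewrite TE.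
under eq_bigr do rewrite -mulr_sumr exchange_big.
rewrite -mulr_sumr exchange_big; congr (_ * _); apply: eq_bigr => f f_ord.
by apply: degree0_ordering => //; exact: indep.
Qed.

(** Serves both directions: the relation between [B] and [B'] holds for [compress] by definition and
    for [expand] because compression undoes it. *)
Lemma union_value_eq (B : blocks Lambda r) (B' : cblocks Lambda r) S :
  (forall X, reps X -> X != fset0 -> (blk0 B X)^T = blk0 B X /\
     cblk0 B' X = (Cmx Lambda r X)^T *m blk0 B X *m Cmx Lambda r X) ->
  cblk_empty B' = blk0 B fset0 -> cblkpos B' = blkpos B ->
  codes Lambda k S ->
  union_value reps k d B S = cunion_value reps k d B' S.
Proof.
move=> B0 Be Bp [codeS _]; rewrite /union_value /cunion_value.
rewrite big_seq_cond [RHS]big_seq_cond; apply: eq_bigr => Q /andP[].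
rewrite fpowersetE => sQS Qk.
pose X := rep reps Q.
have [repX XQ] := repP reps_ok (codes_sub codeS sQS Qk).
have TvalE x y : Tval reps d B x y Q = Tterm r (ent0 (blk0 B X)) 0 x y Q +
    \sum_(1 <= l < d.+1) Tterm r (entpos (cblkpos B' X l)) l x y Q.
  rewrite /Tval big_ltn //=; congr (_ + _); rewrite Bp.
  by apply: eq_big_nat => -[|l].
under eq_bigr do under eq_bigr do rewrite TvalE.
under eq_bigr do rewrite big_split /=.
rewrite big_split /=; congr (_ + _); rewrite /cdegree0.
case: eqVneq => [Q0|Q0].
  have [_ rep0] := rep_fset0 reps_ok.
  by rewrite /X Q0 rep0 Be.
(* An empty representative would have empty image [Q]. *)
have X0 : X != fset0.
  by apply: contraNneq Q0 => X0; case: XQ => O _ <-; rewrite -/X X0 imfset0.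
have [MT ->] := B0 X repX X0.
exact: degree0_contribution.
Qed.

Lemma compress_psd (B : blocks Lambda r) :
  psd_blocks reps d B -> psd_cblocks reps d (compress B).
Proof.
move=> [B0 Bp]; split=> //= [X repX _|]; first exact: psdmx_conj (B0 X repX).
exact: B0 _ (proj1 (rep_fset0 reps_ok)).
Qed.

Lemma expand_psd (B : cblocks Lambda r) :
  psd_cblocks reps d B -> psd_blocks reps d (expand B).
Proof.
move=> [B0 Be Bp]; split=> // X repX.
have [->|X0] := eqVneq X fset0; first by rewrite expand_empty.
(* [J M J^T] is the congruence of [psdmx_conj] taken with the transpose of [J]. *)
by rewrite /= (negPf X0) -{1}[Jmx _ _ _]trmxK; apply/psdmx_conj/B0.
Qed.

Lemma union_value_compress (B : blocks Lambda r) S :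
  psd_blocks reps d B -> codes Lambda k S ->
  union_value reps k d B S = cunion_value reps k d (compress B) S.
Proof.
by move=> [B0 _]; apply: union_value_eq => // X /B0[-> _].
Qed.

Lemma union_value_expand (B : cblocks Lambda r) S :
  psd_cblocks reps d B -> codes Lambda k S ->
  union_value reps k d (expand B) S = cunion_value reps k d B S.
Proof.
move=> /expand_psd[B0 _]; apply: union_value_eq => //; last first.
  by rewrite expand_empty.
move=> X repX X0; have [-> _] := B0 X repX; split=> //.
by rewrite /= (negPf X0) compress_expand.
Qed.

End Comparison.

Theorem proposition7 (R : realType) (n k d : nat) (Lambda : {fset R})
    (reps : set {fset 'cV[R]_n}) (r : enumeration R n)
    (Lambda_range : forall a, a \in Lambda -> -1 <= a < 1)
    (Lambda_neq0 : Lambda != fset0)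
    (k_range : (2 <= k <= n)%N)
    (indep : forall S : {fset 'cV[R]_n}, codes Lambda (k - 2) S -> lin_indep S)
    (reps_ok : type_representatives Lambda (k - 2) reps)
    (r_ok : forall X, reps X -> injective (r X)) :
  [/\ forall B : blocks Lambda r, psd_blocks reps d B ->
        psd_cblocks reps d (compress B) /\
        (forall S, codes Lambda k S -> S != fset0 ->
           union_value reps k d B S = cunion_value reps k d (compress B) S),
      forall B : cblocks Lambda r, psd_cblocks reps d B ->
        psd_blocks reps d (expand B) /\
        (forall S, codes Lambda k S -> S != fset0 ->
           union_value reps k d (expand B) S = cunion_value reps k d B S)
    & (forall X, reps X -> X != fset0 ->
         (q Lambda r X + 1 <= #|` Lambda| ^ #|` X| + 1)%N) /\
      (forall alpha : R,
         feasible Lambda r reps k d alpha <-> cfeasible Lambda r reps k d alpha)].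
Proof.
have cV := union_value_compress Lambda_range indep reps_ok r_ok.
have eV := union_value_expand Lambda_range indep reps_ok r_ok.
split=> [B psdB|B psdB|].
- by split=> [|S codeS _]; [exact: (compress_psd reps_ok) | exact: cV].
- by split=> [|S codeS _]; [exact: expand_psd | exact: eV].
split=> [X _ _|alpha]; first by rewrite leq_add2r card_Ugen.
(* Equal union values make the constraints identical, so compressed or expanded blocks certify the
   same [alpha]. *)
split=> [[B psdB Ble]|[B psdB Ble]].
- exists (compress B) => [|S codeS S0]; first exact: (compress_psd reps_ok).
  by rewrite -cV //; apply: Ble.
- exists (expand B) => [|S codeS S0]; first exact: expand_psd.
  by rewrite eV //; apply: Ble.
Qed.
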